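(* Let $V_1,V_2:\Omega\to[1,\infty)$ be measurable with $V_1\le V_2$, let $\varphi_1,\varphi_2$ be admissible rate functions, and let $S$ be a stochastic operator on $\mathcal M_{V_1}$ and on $\mathcal M_{V_2}$ such that: (1) for $i=1,2$ there exist $K_i>0$, $0<\varsigma_i<1$ with $\|S\mu\|_{V_i}+\varsigma_i\|\mu\|_{\varphi_i(V_i)}\le\|\mu\|_{V_i}+K_i\|\mu\|$ for all $\mu\in\mathcal M_{V_i}$; (2) there exist an integer $N\ge1$, $0<\gamma_H<1$ and constants $A_1>K_1/\varsigma_1$, $A_2>K_2/\varsigma_2$ such that for $i=1,2$ and every $\nu\in\mathcal N_{\varphi_i(V_i)}$ with $\|\nu\|_{\varphi_i(V_i)}\le A_i\|\nu\|$ one has $\|S^N\nu\|\le\gamma_H\|\nu\|$; (3) there is an increasing function $\xi:(0,\infty)\to[0,\infty)$ with $\xi(\lambda)/\lambda\to0$ as $\lambda\to0$ such that $$\lambda V_1\le\varphi_1(V_1)+\xi(\lambda)V_2\quad\text{on }\Omega,\ \text{for all }\lambda>0 .$$ Define $\xi^*(u):=\sup_{\lambda>0}(\lambda u-\xi(\lambda))\in(-\infty,\infty]$, $F(\lambda):=\int_\lambda^1\frac{ds}{\xi^*(s)}$ for $\lambda\in(0,1]$ (with $1/\xi^*(s):=0$ when $\xi^*(s)=+\infty$), and $\Theta(t):=F^{-1}(t):=\inf\{\lambda\in(0,1]:F(\lambda)\le t\}$. Then there exist constants $C>0$ and $0<r<1$, depending only on $\xi,K_i,\varsigma_i,A_i$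 ($i=1,2$), $N$ and $\gamma_H$, such that for every $\nu\in\mathcal N_{V_2}$, $$\|S^n\nu\|_{V_1}\le C\,\Theta(rn)\,\|\nu\|_{V_2}\quad\text{and}\quad\|S^n\nu\|\le\frac{C}{n}\,\Theta(rn)\,\|\nu\|_{V_2}\qquad\text{for all integers }n\ge1 .$$
   Context: Let $(\Omega,\mathcal E)$ be a measurable space. $\mathcal M$ denotes the space of finite signed measures on $\Omega$, $\mathcal P\subset\mathcal M$ the set of probability measures, and $\mathcal N=\{\nu\in\mathcal M:\nu(\Omega)=0\}$. For $\mu\in\mathcal M$ with Hahn–Jordan decomposition $\mu=\mu_+-\mu_-$, $|\mu|=\mu_++\mu_-$ and $\|\mu\|=\int_\Omega d|\mu|$ is the total variation norm. For a measurable $W:\Omega\to[1,\infty)$, $\|\mu\|_W=\int_\Omega W\,d|\mu|$, $\mathcal M_W=\{\mu\in\mathcal M:\|\mu\|_W<\infty\}$, $\mathcal P_W=\mathcal P\cap\mathcal M_W$, $\mathcal N_W=\mathcal N\cap\mathcal M_W$. A stochastic operator is a linear map $S:\mathcal M\to\mathcal M$ with $S(\mathcal P)\subseteq\mathcal P$; it is a stochastic operator on $\mathcal M_W$ if moreover $S(\mathcal M_W)\subseteq\mathcal M_W$ and the restriction is bounded for $\|\cdot\|_W$. An admissible rate function is a concave function $\varphi:[1,\infty)\to[1,\infty)$ with $\varphi(1)=1$ and $\varphi(v)/v\to0$ as $v\to\infty$; $\varphi(V)$ denotes the composition $\varphi\circ V$. *)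

(* Defs.v *)
From HB Require Import structures.
From mathcomp Require Import all_boot all_order all_algebra.
From mathcomp Require Import all_classical all_reals all_analysis.
Set Implicit Arguments. Unset Strict Implicit. Unset Printing Implicit Defensive.
Import Order.TTheory GRing.Theory Num.Theory.
Import numFieldNormedType.Exports.
Local Open Scope classical_set_scope.
Local Open Scope ring_scope.

(* Finite signed measures on (Omega, E) are the
   library's charges {charge set T -> \bar R} (real valued on measurable sets,
   sigma-additive). *)

Section signed_measures.
Context {R : realType} {d : measure_display} {T : measurableType d}.
Local Open Scope ereal_scope.

Definition hahnP (nu : {charge set T -> \bar R}) : set T :=
  projT1 (cid (Hahn_decomposition nu)).
Definition hahnN (nu : {charge set T -> \bar R}) : set T :=
  projT1 (cid (projT2 (cid (Hahn_decomposition nu)))).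
Definition hahnPN (nu : {charge set T -> \bar R}) :
  hahn_decomposition nu (hahnP nu) (hahnN nu) :=
  projT2 (cid (projT2 (cid (Hahn_decomposition nu)))).

Definition tvar (nu : {charge set T -> \bar R}) := charge_variation (hahnPN nu).

Definition normW (W : T -> R) (nu : {charge set T -> \bar R}) : \bar R :=
  \int[tvar nu]_x (W x)%:E.

Definition tvnorm (nu : {charge set T -> \bar R}) : \bar R := normW (fun=> 1%R) nu.

Definition in_MW (W : T -> R) (nu : {charge set T -> \bar R}) : Prop :=
  normW W nu < +oo.
Definition is_prob (nu : {charge set T -> \bar R}) : Prop :=
  (forall A, measurable A -> 0 <= nu A) /\ nu setT = 1.
Definition in_N (nu : {charge set T -> \bar R}) : Prop := nu setT = 0.
Definition in_NW (W : T -> R) (nu : {charge set T -> \bar R}) : Prop :=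
  in_N nu /\ in_MW W nu.

(* S : M -> M is a stochastic operator: linear (as a map of measures,
   i.e. identities hold on the sigma-algebra), well defined on measures,
   and mapping probability measures to probability measures. *)
Definition stochastic_operator
    (S : {charge set T -> \bar R} -> {charge set T -> \bar R}) : Prop :=
  [/\ (forall mu nu : {charge set T -> \bar R}, (forall A, measurable A -> mu A = nu A) ->
         forall A, measurable A -> S mu A = S nu A),
      (forall (mu nu : {charge set T -> \bar R}) A, measurable A -> S (cadd mu nu) A = S mu A + S nu A),
      (forall (c : R) (mu : {charge set T -> \bar R}) A, measurable A -> S (cscale c mu) A = c%:E * S mu A)
    & (forall mu : {charge set T -> \bar R}, is_prob mu -> is_prob (S mu))].

Definition stochastic_operator_on (W : T -> R)
    (S : {charge set T -> \bar R} -> {charge set T -> \bar R}) : Prop :=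
  [/\ stochastic_operator S,
      (forall mu : {charge set T -> \bar R}, in_MW W mu -> in_MW W (S mu))
    & exists c : R, forall mu : {charge set T -> \bar R}, in_MW W mu -> normW W (S mu) <= c%:E * normW W mu].

End signed_measures.

Definition admissible_rate {R : realType} (phi : R -> R) : Prop :=
  [/\ (forall x y t : R, 1 <= x -> 1 <= y -> 0 <= t <= 1 ->
          (1 - t) * phi x + t * phi y <= phi ((1 - t) * x + t * y)),
      (forall v : R, 1 <= v -> 1 <= phi v),
      phi 1 = 1
    & (phi v / v) @[v --> +oo] --> 0].

Section rate.
Context {R : realType} (xi : R -> R).
Local Open Scope ereal_scope.

Definition xi_star (u : R) : \bar R :=
  ereal_sup [set ((lam * u - xi lam)%R)%:E | lam in [set lam : R | (0 < lam)%R]].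

Definition inv_xi_star (s : R) : \bar R :=
  if xi_star s is r%:E then (r^-1)%:E else 0.

Definition Frate (lam : R) : \bar R :=
  \int[lebesgue_measure]_(s in `[lam, 1%R]) inv_xi_star s.

Definition Theta (t : R) : R :=
  inf [set lam : R | (0 < lam <= 1)%R /\ Frate lam <= t%:E].

End rate.

(* Main.v *)
Require Import Defs.
From HB Require Import structures.
From mathcomp Require Import all_boot all_order all_algebra.
From mathcomp Require Import all_classical all_reals all_analysis.
From mathcomp Require Import measurable_realfun lra.
Import Order.TTheory GRing.Theory Num.Theory.
Import numFieldNormedType.Exports.
Set Implicit Arguments.
Unset Strict Implicit.
Unset Printing Implicit Defensive.
Local Open Scope classical_set_scope.
Local Open Scope ring_scope.

(** Along the orbit [f_n = S^n nu] write [a_n], [v_n], [p_n], [w_n] for the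
    norms of [f_n] in total variation, [V1], [phi1(V1)] and [V2].  The window sum
    [L_n = v_n + K / (1 - gammaH) * (a_n + ... + a_(n+N-1))] is a Lyapunov
    function, [L_(n+1) + (s - K / A) p_n <= L_n], and is comparable to [v_n].
    The same construction for [V2] bounds [w_n] by [M w_0], so the interpolation
    [l v_n <= p_n + xi(l) w_n] turns this, after normalising
    [u_n = L_n / (m M w_0)] where [L_n <= m v_n], into [u_(n+1) <= u_n - c xi*(u_n)].
    As [1/xi*] is nonincreasing, [F(u_(n+1)) >= F(u_n) + c], hence
    [F(u_n) >= c n] and [u_n <= Theta(t)] for [t < c n].  Summing the decrease of
    [L] over the second half of [0..n] with [a_k <= p_k] gives the factor [1/n]. *)

(** * Lyapunov functions for real sequences with drift and contraction *)

Definition lyapunov {R : realType} (b : R) (N : nat) (v a : nat -> R) (n : nat) : R :=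
  v n + b * \sum_(i < N) a (n + i)%N.

Section lyapunov.
Context {R : realType} (v p a : nat -> R) (K s A g : R) (N : nat).
Hypotheses (K0 : 0 < K) (s0 : 0 < s) (N0 : (0 < N)%N) (g1 : g < 1) (KA : K / s < A).
Hypotheses (p0 : forall n, 0 <= p n) (a0 : forall n, 0 <= a n).
Hypothesis a_ni : forall n, a n.+1 <= a n.
Hypothesis drift : forall n, v n.+1 + s * p n <= v n + K * a n.
Hypothesis contr : forall n, p n <= A * a n -> a (n + N)%N <= g * a n.

Let L := lyapunov (K / (1 - g)) N v a.

Lemma lyapunov_rate_gt0 : 0 < s - K / A.
Proof.
have A0 : 0 < A by apply: lt_trans KA; exact: divr_gt0.
by rewrite subr_gt0 ltr_pdivrMr// -ltr_pdivrMl// mulrC.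
Qed.

Lemma noninc_addn n k : a (n + k)%N <= a n.
Proof. by elim: k => [|k IH]; rewrite ?addn0// addnS (le_trans (a_ni _)). Qed.

(* Either [p n] dominates [a n], and the drift is strictly negative, or the
   window sum drops by [(1 - g) a n], which pays for the error term [K a n]. *)
Lemma lyapunov_decrease n : L n.+1 + (s - K / A) * p n <= L n.
Proof.
have A0 : 0 < A by apply: lt_trans KA; exact: divr_gt0.
have g1' : 0 < 1 - g by rewrite subr_gt0.
have b0 : 0 < K / (1 - g) by exact: divr_gt0.
(* Writing [N] as [M.+1] exposes the [M] terms [X] common to the windows at [n] and [n.+1]: [a n]
   leaves and [a (n + N)] enters. *)
rewrite /L /lyapunov; case: N N0 contr => [//|M] _ c.
rewrite big_ord_recr/= [in leRHS]big_ord_recl/= addn0 addSnnS.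
under eq_bigr do rewrite addSnnS.
under [in leRHS]eq_bigr do rewrite /= /bump/= add1n.
set X := \sum_(i < M) _.
have dn := drift n.
have KAp : 0 <= K / A * p n by rewrite mulr_ge0// divr_ge0 ?ltW.
have [pA|/ltW Ap] := leP (p n) (A * a n).
- have := c n pA.
  rewrite -(ler_pM2l b0).
  have e : K / (1 - g) * (g * a n) = K / (1 - g) * a n - K * a n.
    have := divfK (lt0r_neq0 g1') K; set q := K / (1 - g) => qE.
    by rewrite -qE; lra.
  rewrite e !mulrDr; lra.
- have Kp : K * a n <= K / A * p n.
    by rewrite mulrAC ler_pdivlMr// -mulrA (ler_pM2l K0) mulrC.
  have := noninc_addn n M.+1; rewrite -(ler_pM2l b0) !mulrDr; lra.
Qed.

Lemma lyapunov_ge n : v n <= L n.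
Proof.
by rewrite /L /lyapunov lerDl mulr_ge0 ?sumr_ge0// divr_ge0 ?ltW// subr_gt0.
Qed.

Lemma lyapunov_le n : a n <= v n -> L n <= (1 + K / (1 - g) * N%:R) * v n.
Proof.
move=> av; rewrite /L /lyapunov.
have : 0 <= K / (1 - g) by rewrite divr_ge0 ?ltW// subr_gt0.
move: (K / (1 - g)) => b b0; rewrite mulrDl mul1r lerD2l -mulrA.
apply: ler_wpM2l => //.
apply: (@le_trans _ _ (\sum_(i < N) v n)).
  by apply: ler_sum => i _; exact: le_trans (noninc_addn _ _) av.
by rewrite sumr_const card_ord mulr_natl.
Qed.

Lemma lyapunov_noninc n k : L (n + k)%N <= L n.
Proof.
elim: k => [|k IH]; rewrite ?addn0// addnS (le_trans _ IH)//.
apply: le_trans (lyapunov_decrease _); rewrite lerDl mulr_ge0//.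
exact/ltW/lyapunov_rate_gt0.
Qed.

(** Telescoping the decrease over the [k.+1] indices from [n] to [n + k] bounds the sum of the
    [p j], and each [p j >= a j >= a (n + k)] because [a] is nonincreasing. *)
Lemma lyapunov_average n k : (forall j, a j <= p j) -> (forall j, 0 <= v j) ->
  (s - K / A) * (k.+1%:R * a (n + k)%N) <= L n.
Proof.
move=> ap v0; have d0 := ltW lyapunov_rate_gt0.
(* The induction keeps the current value of [L] on the left and counts [k] terms; the last one comes
   from one more decrease, after which [L (n + k).+1 >= 0] is dropped. *)
suff: L (n + k)%N + (s - K / A) * (k%:R * a (n + k)%N) <= L n.
  have := le_trans (v0 _) (lyapunov_ge (n + k).+1).
  have := lyapunov_decrease (n + k).
  have : (s - K / A) * a (n + k)%N <= (s - K / A) * p (n + k)%N by exact: ler_wpM2l.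
  by rewrite -natr1; lra.
elim: k => [|k IH]; first by rewrite addn0 mul0r mulr0 addr0.
have := lyapunov_decrease (n + k); rewrite -addnS => D; apply: le_trans IH.
rewrite -natr1 mulrDl.
have X1 : a (n + k.+1)%N <= a (n + k)%N by rewrite addnS.
have X2 : (s - K / A) * a (n + k.+1)%N <= (s - K / A) * p (n + k)%N.
  by apply: ler_wpM2l => //; exact: le_trans (ap _).
have X3 : (s - K / A) * (k%:R * a (n + k.+1)%N) <= (s - K / A) * (k%:R * a (n + k)%N).
  by apply: ler_wpM2l => //; apply: ler_wpM2l.
by lra.
Qed.

End lyapunov.

(** * The conjugate [xi_star], the integral [Frate] and its inverse [Theta] *)

Section rate_function.
Context {R : realType} (xi : R -> R).
Hypothesis xi_small : (xi l / l) @[l --> 0^'+] --> 0.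
Local Open Scope ereal_scope.

Lemma xi_star_ge (l u : R) : (0 < l)%R -> (l * u - xi l)%:E <= xi_star xi u.
Proof. by move=> l0; apply: ereal_sup_ubound; exists l. Qed.

Lemma le_xi_star (u w : R) : (u <= w)%R -> xi_star xi u <= xi_star xi w.
Proof.
move=> uw; apply: ge_ereal_sup => _ [l/= l0 <-].
by apply: le_trans (xi_star_ge w l0); rewrite lee_fin lerD2r ler_pM2l.
Qed.

(** Since [xi l / l] tends to 0, some [l > 0] has [xi l < l * u], and this [l] makes the supremum
    positive. *)
Lemma xi_star_gt0 (u : R) : (0 < u)%R -> 0 < xi_star xi u.
Proof.
move=> u0; have [l [l0 xl]] : exists l : R, (0 < l)%R /\ (xi l / l < u)%R.
  near (0%R : R)^'+ => l; exists l; split; first by near: l; exact: nbhs_right_gt.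
  near: l; have := cvgr_lt (0%R : R) xi_small; exact.
apply: lt_le_trans (xi_star_ge u l0).
by rewrite lte_fin subr_gt0 mulrC -ltr_pdivrMr.
Unshelve. all: by end_near.
Qed.

Lemma inv_xi_star_ge0 (u : R) : (0 < u)%R -> 0 <= inv_xi_star xi u.
Proof.
move=> /xi_star_gt0; rewrite /inv_xi_star; case: (xi_star xi u) => [r| |]//.
by rewrite lte_fin lee_fin invr_ge0 => /ltW.
Qed.

Lemma inv_xi_star_fin (u : R) : inv_xi_star xi u = (fine (inv_xi_star xi u))%:E.
Proof. by rewrite /inv_xi_star; case: xi_star. Qed.

(** Inversion reverses the order only among positive values, hence [0 < u]; the value 0 given to the
    inverse of [+oo] is consistent with this monotonicity. *)
Lemma le_inv_xi_star (u w : R) : (0 < u)%R -> (u <= w)%R ->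
  inv_xi_star xi w <= inv_xi_star xi u.
Proof.
move=> u0 uw; have := le_xi_star uw; have := xi_star_gt0 u0.
rewrite /inv_xi_star.
case: (xi_star xi u) => [r| |]//; case: (xi_star xi w) => [q| |]//.
- rewrite lte_fin !lee_fin => r0 rq; rewrite lef_pV2// posrE//.
  exact: lt_le_trans rq.
- by rewrite lte_fin lee_fin invr_ge0 => /ltW.
Qed.

(** Monotonicity is known only on positive arguments. Composing with [Num.max u] gives a function
    that is nonincreasing on the whole line and agrees with the original on the interval. *)
Lemma measurable_inv_xi_star (u w : R) : (0 < u)%R ->
  measurable_fun (`[u, w] : set R) (inv_xi_star xi : R -> \bar R).
Proof.
move=> u0; pose h (s : R) := fine (inv_xi_star xi (Num.max u s)).
have mh : measurable_fun `[u, w] (EFin \o h).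
  apply/measurable_EFinP; apply: nonincreasing_measurable => // x y xy.
  rewrite /h -lee_fin -!inv_xi_star_fin le_inv_xi_star//.
    by rewrite lt_max u0.
  by rewrite ge_max !le_max lexx xy orbT.
apply: eq_measurable_fun mh => x; rewrite inE/= in_itv/= => /andP[ux _].
by rewrite /h -inv_xi_star_fin (max_idPr ux).
Qed.

Lemma le_Frate (l m : R) : (0 < l)%R -> (l <= m)%R -> Frate xi m <= Frate xi l.
Proof.
move=> l0 lm; apply: ge0_subset_integral => //.
- exact: measurable_inv_xi_star.
- move=> x/=; rewrite in_itv/= => /andP[lx _]; apply: inv_xi_star_ge0.
  exact: lt_le_trans lx.
- by apply: subset_itvr; rewrite bnd_simp.
Qed.

Lemma Frate1 : Frate xi 1 = 0.
Proof. by rewrite /Frate set_itv1 integral_set1. Qed.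

(* The increment of [Frate] over [[u', u]] is at least the length of the
   interval times the value [1 / xi_star u] of the integrand at its right end. *)
Lemma Frate_step (c u u' : R) : (0 < c)%R -> (0 < u')%R -> (u' <= u <= 1)%R ->
  (forall l, 0 < l -> u' + c * (l * u - xi l) <= u)%R ->
  Frate xi u + c%:E <= Frate xi u'.
Proof.
move=> c0 u'0 /andP[u'u u1] H.
have u0 : (0 < u)%R by exact: lt_le_trans u'u.
(* Taking the supremum of [H] over [l]; the bound also forces [xi_star xi u] to be finite. *)
have Hs : c%:E * xi_star xi u <= (u - u')%:E.
  rewrite -lee_pdivlMl//; apply: ge_ereal_sup => _ [l/= l0 <-].
  by rewrite -EFinM lee_fin ler_pdivlMl//; have := H _ l0; lra.
have [q q0 qE] : exists2 q : R, (0 < q)%R & xi_star xi u = q%:E.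
  move: Hs (xi_star_gt0 u0); case: (xi_star xi u) => [q _ q0|+ _|]//.
  - by exists q.
  - by rewrite gt0_muley.
have cq : (c <= q^-1 * (u - u'))%R.
  by move: Hs; rewrite qE -EFinM lee_fin ler_pdivlMl// mulrC.
have mf := @measurable_inv_xi_star u' 1 u'0.
have U : `[u', 1%R]%classic = `[u', u[%classic `|` `[u, 1%R]%classic.
  by rewrite -itv_bndbnd_setU// bnd_simp.
have f0 x : x \in `[u', 1%R] -> 0 <= inv_xi_star xi x.
  rewrite in_itv/= => /andP[u'x _]; apply: inv_xi_star_ge0.
  exact: lt_le_trans u'x.
rewrite [leRHS]/Frate U ge0_integral_setU//; last 3 first.
- by rewrite -U.
- by rewrite -U => x /f0.
- apply/disj_setPLR => x/=; rewrite !in_itv/= => /andP[_ xu].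
  by apply/negP; rewrite negb_and -ltNge xu.
rewrite -/(Frate xi u) addeC leeD2l//.
(* On the piece added to [Frate xi u], the integrand is nonincreasing, hence at least its value
   [q^-1] at [u]. *)
apply: (@le_trans _ _ (\int[lebesgue_measure]_(s in `[u', u[) (cst (q^-1)%:E s))).
  rewrite integral_cst//= lebesgue_measure_itv/= lte_fin.
  case: ltP => [_|uu']; first by rewrite -EFinD -EFinM lee_fin.
  by move: cq; rewrite (le_anti (introT andP (conj u'u uu'))) subrr mulr0 mule0.
apply: ge0_le_integral => //.
- by move=> x _; rewrite lee_fin invr_ge0 ltW.
- by apply: measurable_funS mf => //; rewrite U; exact: subsetUl.
- move=> x; rewrite /= in_itv/= => /andP[ux xu].
  have -> : (q^-1)%:E = inv_xi_star xi u by rewrite /inv_xi_star qE.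
  by apply: le_inv_xi_star (ltW xu); exact: lt_le_trans ux.
Qed.

(** If some [l < u] had [Frate xi l <= t], monotonicity would give [Frate xi u <= t]. The condition
    [0 <= t] puts 1 in the set defining [Theta], so the infimum is not that of an empty set. *)
Lemma le_Theta (t u : R) : (0 <= t)%R -> (0 <= u)%R ->
  ((0 < u)%R -> t%:E < Frate xi u) -> (u <= Theta xi t)%R.
Proof.
move=> t0 u0 tF; apply: lb_le_inf.
  by exists 1%R; split; [rewrite ltr01/=|rewrite Frate1 lee_fin].
move=> l/= [/andP[l0 l1] Fl]; rewrite leNgt; apply/negP => lu.
have up := lt_trans l0 lu.
have := lt_le_trans (tF up) (le_trans (le_Frate l0 (ltW lu)) Fl).
by rewrite ltxx.
Qed.

(** Each step raises [Frate] by at least [c], so [Frate xi (u n) >= c * n] as long as [u n] is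
    positive; [le_Theta] then needs [t] strictly below [c * n]. *)
Lemma le_Theta_seq (c : R) (u : nat -> R) : (0 < c)%R ->
  (forall n, 0 <= u n)%R -> (u 0%N <= 1)%R -> (forall n, u n.+1 <= u n)%R ->
  (forall n l, 0 < l -> u n.+1 + c * (l * u n - xi l) <= u n)%R ->
  forall (t : R) n, (0 <= t < c * n%:R)%R -> (u n <= Theta xi t)%R.
Proof.
move=> c0 u0 u1 un H t n /andP[t0 tn]; apply: le_Theta => // un0.
have {}u1 k : (u k <= 1)%R by elim: k => // k IH; exact: le_trans (un k) IH.
apply: (@lt_le_trans _ _ (c * n%:R)%:E); first by rewrite lte_fin.
elim: n un0 {tn} => [|n IH] un0.
  rewrite mulr0; apply: integral_ge0 => x/=; rewrite in_itv/= => /andP[ux _].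
  by apply: inv_xi_star_ge0; exact: lt_le_trans ux.
have un0' := lt_le_trans un0 (un n).
apply: le_trans (Frate_step c0 un0 _ (H n)); last by rewrite un u1.
by rewrite -natr1 mulrDr mulr1 EFinD leeD2r// IH.
Qed.

Lemma le_Theta_scaled (c Q : R) (L : nat -> R) : (0 < c)%R ->
  (forall n, 0 <= L n)%R -> (L 0%N <= Q)%R -> (forall n, L n.+1 <= L n)%R ->
  (forall n l, 0 < l -> L n.+1 + c * (l * L n - xi l * Q) <= L n)%R ->
  forall (t : R) n, (0 <= t < c * n%:R)%R -> (L n <= Theta xi t * Q)%R.
Proof.
move=> c0 L0 LQ Ln H t n tn.
have := le_trans (L0 0%N) LQ; rewrite le_eqVlt => /predU1P[Q0|Q0].
  (* With [Q = 0] no normalisation is possible, but then [L] is bounded by 0 throughout. *)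
  rewrite -Q0 mulr0; elim: n {tn} => [|n IH]; first by rewrite Q0.
  exact: le_trans (Ln n) IH.
rewrite -ler_pdivrMr//; apply: (le_Theta_seq (u := fun n => (L n / Q)%R) c0) tn.
- by move=> k; rewrite divr_ge0// ltW.
- by rewrite ler_pdivrMr// mul1r.
- by move=> k; rewrite ler_pM2r ?invr_gt0.
- move=> k l l0; have := H k l l0; rewrite -(ler_pM2r (_ : 0 < Q^-1)%R) ?invr_gt0//.
  apply: le_trans; rewrite le_eqVlt; apply/orP; left; apply/eqP.
  rewrite mulrDl -mulrA mulrBl [(xi l * Q / Q)%R]mulfK ?lt0r_neq0//.
  by rewrite mulrA.
Qed.

End rate_function.

(** * Monotonicity and measurability of admissible rates *)

Section admissible.
Context {R : realType} (phi : R -> R).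
Hypothesis adm : admissible_rate phi.

(* A decrease [phi y < phi x] would, by concavity, propagate linearly and push
   [phi] below [1] far enough to the right. *)
Lemma admissible_rate_nondecreasing (x y : R) : 1 <= x -> x <= y -> phi x <= phi y.
Proof.
case: adm => conc ge1 _ _ x1; rewrite le_eqVlt => /predU1P[->//|xy].
rewrite leNgt; apply/negP => yx.
pose D := phi x - phi y; have D0 : 0 < D by rewrite subr_gt0.
(* As [D + phi y = phi x], this [t] gives [(1 - t) * phi x = phi y]. With [phi z >= 1], concavity at
   [y] would yield [phi y + t <= phi y]. *)
pose t := D / (D + phi y).
have y1 : 1 <= y by lra.
have py := ge1 _ y1.
have t0 : 0 < t by rewrite divr_gt0//; lra.
have t1 : t <= 1 by rewrite ler_pdivrMr ?mul1r; lra.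
pose z := x + (y - x) / t.
have yz : y = (1 - t) * x + t * z.
  by rewrite /z mulrDr mulrCA divff ?lt0r_neq0//; lra.
have z1 : 1 <= z.
  have : 0 < (y - x) / t by rewrite divr_gt0// subr_gt0.
  by rewrite /z; lra.
have := conc x z t x1 z1; rewrite -yz (ltW t0) t1 => /(_ isT).
have pz := ge1 _ z1.
have : t * 1 <= t * phi z by rewrite ler_pM2l.
have : t * phi x = D.
  by rewrite /t (_ : D + phi y = phi x) ?divfK//; rewrite ?/D; lra.
rewrite mulr1 mulrBl mul1r /D; lra.
Qed.

(** [phi] is controlled only on [[1, +oo)]; truncating its argument from below at 1 makes it
    monotone on the whole line without changing [phi \o V]. *)
Lemma measurable_admissible_rate d (T : measurableType d) (V : T -> R) :
  measurable_fun setT V -> (forall x, 1 <= V x) -> measurable_fun setT (phi \o V).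
Proof.
move=> mV V1.
have -> : phi \o V = (phi \o Num.max 1) \o V.
  by apply/funext => x /=; rewrite (max_idPr (V1 x)).
apply: measurableT_comp => //; apply: nondecreasing_measurable => // x y xy /=.
apply: admissible_rate_nondecreasing; first by rewrite le_max lexx.
by rewrite ge_max !le_max lexx xy orbT.
Qed.

End admissible.

(** * Weighted norms of charges and stochastic operators *)

Section charges.
Context {R : realType} {d : measure_display} {T : measurableType d}.
Local Open Scope ereal_scope.
Implicit Types nu mu : {charge set T -> \bar R}.

Lemma tvnormE nu : tvnorm nu = tvar nu setT.
Proof. by rewrite /tvnorm /normW integral_cst// mul1e. Qed.

Lemma tvnorm_fin nu : tvnorm nu \is a fin_num.
Proof.
by rewrite tvnormE /tvar /charge_variation/= fin_numD !fin_num_measure.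
Qed.

Lemma normW_ge0 (W : T -> R) nu : (forall x, 0 <= W x)%R -> 0 <= normW W nu.
Proof. by move=> W0; apply: integral_ge0 => x _; rewrite lee_fin. Qed.

Lemma le_normW (V W : T -> R) nu : (forall x, 0 <= V x)%R ->
  measurable_fun setT V -> measurable_fun setT W ->
  (forall x, V x <= W x)%R -> normW V nu <= normW W nu.
Proof.
move=> V0 mV mW VW; apply: ge0_le_integral => //.
- by move=> x _; rewrite lee_fin.
- exact/measurable_EFinP.
- exact/measurable_EFinP.
- by move=> x _; rewrite lee_fin.
Qed.

Lemma normWD (V W : T -> R) nu : (forall x, 0 <= V x)%R -> (forall x, 0 <= W x)%R ->
  measurable_fun setT V -> measurable_fun setT W ->
  normW (V \+ W)%R nu = normW V nu + normW W nu.
Proof.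
move=> V0 W0 mV mW; rewrite /normW -ge0_integralD//.
- by move=> x _; rewrite lee_fin.
- exact/measurable_EFinP.
- by move=> x _; rewrite lee_fin.
- exact/measurable_EFinP.
Qed.

Lemma normWZ (c : R) (W : T -> R) nu : (0 <= c)%R -> (forall x, 0 <= W x)%R ->
  measurable_fun setT W -> normW (fun x => c * W x)%R nu = c%:E * normW W nu.
Proof.
move=> c0 W0 mW; rewrite /normW -ge0_integralZl_EFin//.
- by move=> x _; rewrite lee_fin.
- exact/measurable_EFinP.
Qed.

Lemma le_charge_setT nu A : (forall B, measurable B -> 0 <= nu B) ->
  measurable A -> nu A <= nu setT.
Proof.
move=> nu0 mA; have mC : measurable (~` A) by exact: measurableC.
by rewrite -(setUv A) chargeU// ?setICr// leeDl// nu0.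
Qed.

Section stochastic.
Context (S : {charge set T -> \bar R} -> {charge set T -> \bar R}).
Hypothesis stoS : stochastic_operator S.

(** Positive mass reduces to a probability by normalisation. A nonnegative charge of mass zero
    vanishes on measurable sets, hence equals its multiple by 0, which [S] sends to zero. *)
Lemma stochastic_ge0 nu : (forall A, measurable A -> 0 <= nu A) ->
  (forall A, measurable A -> 0 <= S nu A) /\ S nu setT = nu setT.
Proof.
case: stoS => Sext _ Sscale Sprob nu0.
have nuTfin : nu setT \is a fin_num by exact: fin_num_measure.
have := nu0 _ measurableT; rewrite le_eqVlt => /predU1P[nuT0|nuT0].
- have S0 A : measurable A -> S nu A = 0.
    move=> mA; rewrite -[RHS](mul0e (S nu A)) -(Sscale 0%R nu A mA).
    apply: Sext => // B mB; rewrite /= /cscale mul0e.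
    by apply/eqP; rewrite eq_le nu0// andbT nuT0 le_charge_setT.
  by split=> [A mA|]; rewrite S0.
- pose c := fine (nu setT).
  have cE : nu setT = c%:E by rewrite fineK.
  have c0 : (0 < c)%R by rewrite -lte_fin -cE.
  pose rho : {charge set T -> \bar R} := cscale (c^-1) nu.
  have Prho : is_prob rho.
    split=> [A mA|]; rewrite /rho/= /cscale.
      by rewrite mule_ge0// ?nu0// lee_fin invr_ge0 ltW.
    by rewrite cE -EFinM mulVf ?lt0r_neq0.
  have [Sr0 Sr1] := Sprob _ Prho.
  have SE A : measurable A -> S nu A = c%:E * S rho A.
    move=> mA; rewrite -(Sscale c rho A mA); apply: Sext => // B mB.
    by rewrite /rho /= /cscale/= /cscale muleA -EFinM divff ?lt0r_neq0// mul1e.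
  split=> [A mA|]; rewrite SE//.
    by rewrite mule_ge0 ?Sr0// lee_fin ltW.
  by rewrite Sr1 mule1 cE.
Qed.

Lemma stochastic_jordan nu (P := jordan_pos (hahnPN nu)) (N := jordan_neg (hahnPN nu)) A :
  measurable A -> S nu A = S P A - S N A.
Proof.
case: stoS => Sext Sadd Sscale Sprob mA.
rewrite (Sext nu (cadd P (cscale (-1) N)) _ A mA); last first.
  by move=> B mB; exact: jordan_decomp.
by rewrite Sadd// Sscale// mulN1e.
Qed.

Lemma stochastic_mass nu : S nu setT = nu setT.
Proof.
have [_ P1] := @stochastic_ge0 (jordan_pos (hahnPN nu)) (fun A _ => measure_ge0 _ A).
have [_ N1] := @stochastic_ge0 (jordan_neg (hahnPN nu)) (fun A _ => measure_ge0 _ A).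
rewrite stochastic_jordan// P1 N1.
by rewrite [RHS](jordan_decomp (hahnPN nu) measurableT) /= /cadd/= cscaleN1.
Qed.

(** Evaluate [S nu] on its own Hahn sets [X] and [Y] and split it into the images of the Jordan
    parts of [nu]. These images are nonnegative and preserve mass, so each contributes at most its
    total mass to the variation. *)
Lemma stochastic_contraction nu : tvnorm (S nu) <= tvnorm nu.
Proof.
have [P0 P1] := @stochastic_ge0 (jordan_pos (hahnPN nu)) (fun A _ => measure_ge0 _ A).
have [N0 N1] := @stochastic_ge0 (jordan_neg (hahnPN nu)) (fun A _ => measure_ge0 _ A).
rewrite !tvnormE /tvar /charge_variation.
rewrite [leRHS](_ : _ = S (jordan_pos (hahnPN nu)) setT + S (jordan_neg (hahnPN nu)) setT);
  last by rewrite P1 N1.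
have [[mX _] [mY _] _ _] := hahnPN (S nu).
rewrite /= !jordan_posE !jordan_negE cjordan_posE cjordan_negE.
rewrite /crestr0 mem_set//= /crestr !setTI (stochastic_jordan nu mX) (stochastic_jordan nu mY).
have PX := le_charge_setT P0 mX; have NY := le_charge_setT N0 mY.
have := P0 _ mY; have := N0 _ mX; move: PX NY.
have fS mu B : measurable B -> exists r : R, S mu B = r%:E.
  by move=> mB; exists (fine (S mu B)); rewrite fineK// fin_num_measure.
have [a1 ->] := fS (jordan_pos (hahnPN nu)) _ mX.
have [a2 ->] := fS (jordan_pos (hahnPN nu)) _ mY.
have [a3 ->] := fS (jordan_pos (hahnPN nu)) _ measurableT.
have [b1 ->] := fS (jordan_neg (hahnPN nu)) _ mX.
have [b2 ->] := fS (jordan_neg (hahnPN nu)) _ mY.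
have [b3 ->] := fS (jordan_neg (hahnPN nu)) _ measurableT.
by rewrite -?EFinN -?EFinD !lee_fin; lra.
Qed.

End stochastic.
End charges.

(** * Lyapunov estimates along the orbit of a charge of zero mass *)

Section harris.
Context {R : realType} {d : measure_display} {T : measurableType d}.
Context (V : T -> R) (phi : R -> R).
Context (S : {charge set T -> \bar R} -> {charge set T -> \bar R}).
Context (K s A g : R) (N : nat) (nu : {charge set T -> \bar R}).
Hypotheses (mV : measurable_fun setT V) (V1 : forall x, 1 <= V x).
Hypotheses (adm : admissible_rate phi) (stoS : stochastic_operator_on V S).
Hypotheses (K0 : 0 < K) (s0 : 0 < s) (N0 : (0 < N)%N) (g1 : g < 1) (KA : K / s < A).
Hypothesis drift : forall mu, in_MW V mu ->
  (normW V (S mu) + s%:E * normW (phi \o V) mu <= normW V mu + K%:E * tvnorm mu)%E.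
Hypothesis contr : forall mu, in_NW (phi \o V) mu ->
  (normW (phi \o V) mu <= A%:E * tvnorm mu)%E ->
  (tvnorm (iter N S mu) <= g%:E * tvnorm mu)%E.
Hypothesis nuN : in_NW V nu.

Let v n : R := fine (normW V (iter n S nu)).
Let p n : R := fine (normW (phi \o V) (iter n S nu)).
Let a n : R := fine (tvnorm (iter n S nu)).

Let V_ge0 x : 0 <= V x. Proof. exact: le_trans (V1 x). Qed.

Let phiV1 x : 1 <= phi (V x). Proof. by case: adm => _ + _ _; apply. Qed.

Let phiV_ge0 x : 0 <= phi (V x). Proof. exact: le_trans (phiV1 x). Qed.

Lemma in_NW_iter n : in_NW V (iter n S nu).
Proof.
case: stoS => sto SW _; elim: n => // n [IN IW]; split => /=; last exact: SW.
by rewrite /in_N stochastic_mass.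
Qed.

Lemma normW_iterE n : normW V (iter n S nu) = (v n)%:E.
Proof.
have [_ W] := in_NW_iter n.
by rewrite fineK// ge0_fin_numE// normW_ge0.
Qed.

Lemma tvnorm_iterE n : tvnorm (iter n S nu) = (a n)%:E.
Proof. by rewrite fineK// tvnorm_fin. Qed.

(** Finiteness is read off the drift condition: its right side is finite and [s > 0], so an infinite
    rate norm on the left is impossible. *)
Lemma normW_rate_iterE n : normW (phi \o V) (iter n S nu) = (p n)%:E.
Proof.
have [_ W] := in_NW_iter n.
rewrite fineK// ge0_fin_numE ?normW_ge0//.
have := drift W.
have := normW_iterE n.+1; rewrite iterS => ->; rewrite normW_iterE tvnorm_iterE.
have := normW_ge0 (iter n S nu) phiV_ge0; rewrite /comp.
case: normW => [r| |]//= _; first by rewrite ltry.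
by rewrite gt0_muley ?lte_fin// addey.
Qed.

Lemma iter_drift n : v n.+1 + s * p n <= v n + K * a n.
Proof.
have [_ W] := in_NW_iter n; have := drift W.
have := normW_iterE n.+1; rewrite iterS => ->.
by rewrite normW_iterE tvnorm_iterE normW_rate_iterE -!EFinM -!EFinD lee_fin.
Qed.

Lemma iter_contr n : p n <= A * a n -> a (n + N)%N <= g * a n.
Proof.
move=> pA; rewrite addnC -lee_fin EFinM -!tvnorm_iterE iterD; apply: contr.
- have [IN _] := in_NW_iter n; split => //.
  by rewrite /in_MW normW_rate_iterE ltry.
- by rewrite normW_rate_iterE tvnorm_iterE -EFinM lee_fin.
Qed.

Lemma iter_tvnorm_noninc n : a n.+1 <= a n.
Proof.
by rewrite -lee_fin -!tvnorm_iterE iterS; case: stoS => sto _ _; exact: stochastic_contraction.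
Qed.

Lemma iter_tvnorm_ge0 n : 0 <= a n.
Proof. by rewrite -lee_fin -tvnorm_iterE normW_ge0. Qed.

Lemma iter_tvnorm_le n : a n <= v n.
Proof. by rewrite -lee_fin -tvnorm_iterE -normW_iterE; apply: le_normW. Qed.

Lemma iter_tvnorm_le_rate n : a n <= p n.
Proof.
rewrite -lee_fin -tvnorm_iterE -normW_rate_iterE; apply: le_normW => //.
exact: measurable_admissible_rate.
Qed.

Lemma iter_rate_ge0 n : 0 <= p n.
Proof. exact: le_trans (iter_tvnorm_ge0 n) (iter_tvnorm_le_rate n). Qed.

Lemma iter_normW_ge0 n : 0 <= v n.
Proof. exact: le_trans (iter_tvnorm_ge0 n) (iter_tvnorm_le n). Qed.

Lemma iter_lyapunov_ge n : v n <= lyapunov (K / (1 - g)) N v a n.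
Proof. exact: lyapunov_ge K0 g1 iter_tvnorm_ge0 n. Qed.

Lemma iter_lyapunov_le n :
  lyapunov (K / (1 - g)) N v a n <= (1 + K / (1 - g) * N%:R) * v n.
Proof. exact: lyapunov_le K0 g1 iter_tvnorm_noninc _ (iter_tvnorm_le n). Qed.

Lemma iter_lyapunov_decrease n :
  lyapunov (K / (1 - g)) N v a n.+1 + (s - K / A) * p n
    <= lyapunov (K / (1 - g)) N v a n.
Proof.
exact: (lyapunov_decrease K0 s0 N0 g1 KA iter_rate_ge0 iter_tvnorm_noninc
  iter_drift iter_contr).
Qed.

Lemma iter_lyapunov_noninc n k :
  lyapunov (K / (1 - g)) N v a (n + k) <= lyapunov (K / (1 - g)) N v a n.
Proof.
exact: (lyapunov_noninc K0 s0 N0 g1 KA iter_rate_ge0 iter_tvnorm_noninc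
  iter_drift iter_contr).
Qed.

Lemma iter_lyapunov_average n k :
  (s - K / A) * (k.+1%:R * a (n + k)%N) <= lyapunov (K / (1 - g)) N v a n.
Proof.
exact: (lyapunov_average K0 s0 N0 g1 KA iter_rate_ge0 iter_tvnorm_ge0
  iter_tvnorm_noninc iter_drift iter_contr _ _ iter_tvnorm_le_rate iter_normW_ge0).
Qed.

(** The window sum is nonincreasing and comparable to [v]. Applied to [V2], this is the uniform
    bound on the second weight that the interpolation requires. *)
Lemma iter_normW_bounded n : v n <= (1 + K / (1 - g) * N%:R) * v 0%N.
Proof.
apply: le_trans (iter_lyapunov_ge n) _.
exact: le_trans (iter_lyapunov_noninc 0 n) (iter_lyapunov_le 0).
Qed.

End harris.

(** * Interpolation between the two weights and the convergence rate *)

Unset Implicit Arguments.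

Theorem theorem4p8 (R : realType) (xi : R -> R)
    (K1 K2 s1 s2 A1 A2 gammaH : R) (N : nat) :
  0 < K1 -> 0 < K2 -> 0 < s1 < 1 -> 0 < s2 < 1 ->
  (0 < N)%N -> 0 < gammaH < 1 ->
  K1 / s1 < A1 -> K2 / s2 < A2 ->
  (forall l, 0 < l -> 0 <= xi l) ->
  (forall l m, 0 < l -> l <= m -> xi l <= xi m) ->
  (xi l / l) @[l --> 0^'+] --> 0 ->
  exists (C r : R), 0 < C /\ 0 < r < 1 /\
  forall (d : measure_display) (T : measurableType d)
         (V1 V2 : T -> R) (phi1 phi2 : R -> R)
         (S : {charge set T -> \bar R} -> {charge set T -> \bar R}),
    measurable_fun setT V1 -> measurable_fun setT V2 ->
    (forall x, 1 <= V1 x) -> (forall x, 1 <= V2 x) ->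
    (forall x, V1 x <= V2 x) ->
    admissible_rate phi1 -> admissible_rate phi2 ->
    stochastic_operator_on V1 S -> stochastic_operator_on V2 S ->
    (* (1) *)
    (forall mu, in_MW V1 mu ->
       (normW V1 (S mu) + s1%:E * normW (phi1 \o V1) mu
          <= normW V1 mu + K1%:E * tvnorm mu)%E) ->
    (forall mu, in_MW V2 mu ->
       (normW V2 (S mu) + s2%:E * normW (phi2 \o V2) mu
          <= normW V2 mu + K2%:E * tvnorm mu)%E) ->
    (* (2) *)
    (forall nu, in_NW (phi1 \o V1) nu ->
       (normW (phi1 \o V1) nu <= A1%:E * tvnorm nu)%E ->
       (tvnorm (iter N S nu) <= gammaH%:E * tvnorm nu)%E) ->
    (forall nu, in_NW (phi2 \o V2) nu ->
       (normW (phi2 \o V2) nu <= A2%:E * tvnorm nu)%E ->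
       (tvnorm (iter N S nu) <= gammaH%:E * tvnorm nu)%E) ->
    (* (3) *)
    (forall l, 0 < l -> forall x, l * V1 x <= phi1 (V1 x) + xi l * V2 x) ->
    forall nu, in_NW V2 nu ->
    forall n : nat, (1 <= n)%N ->
      (normW V1 (iter n S nu) <= (C * Theta xi (r * n%:R))%:E * normW V2 nu)%E /\
      (tvnorm (iter n S nu) <= (C / n%:R * Theta xi (r * n%:R))%:E * normW V2 nu)%E.
Proof.
move=> K10 K20 /andP[s10 s11] /andP[s20 _] N0 /andP[_ g1] KA1 KA2 xi0 _ xi_small.
have dl0 := lyapunov_rate_gt0 K10 s10 KA1.
have dl1 : s1 - K1 / A1 < 1.
  have A10 : 0 < A1 by apply: lt_trans KA1; exact: divr_gt0.
  by have := divr_gt0 K10 A10; lra.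
have one_le (K : R) : 0 < K -> 1 <= 1 + K / (1 - gammaH) * N%:R.
  by move=> K0; rewrite lerDl mulr_ge0// divr_ge0 ?ltW// subr_gt0.
have m1 := one_le _ K10; have M1 := one_le _ K20.
set dl := s1 - K1 / A1 in dl0 dl1.
set m := 1 + K1 / (1 - gammaH) * N%:R in m1.
set M := 1 + K2 / (1 - gammaH) * N%:R in M1.
have m0 : 0 < m by lra.
have M0 : 0 < M by lra.
have c0 : 0 < dl / m by exact: divr_gt0.
(* [dl / m] is the gain of [Frate] per step and [m * M] comes from the normalisation. The factor
   [2 / dl] comes from averaging over half of the steps. The 4 is a 2 for evaluating at half time
   and a 2 for the strict inequality that [key] asks for. *)
exists (2 * (m * M) / dl), (dl / m / 4).
split; first by rewrite !(divr_gt0, mulr_gt0).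
split.
  rewrite divr_gt0//= ltr_pdivrMr// ltr_pdivrMr//.
  by rewrite mulrAC (lt_le_trans dl1)// mul1r; lra.
move=> d T V1 V2 phi1 phi2 S mV1 mV2 V1_ge1 V2_ge1 V12 adm1 adm2 sto1 sto2.
move=> drift1 drift2 contr1 contr2 Hxi nu [nuN nuW2] n n1.
have V1_ge0 x : 0 <= V1 x by exact: le_trans (V1_ge1 x).
have V2_ge0 x : 0 <= V2 x by exact: le_trans (V2_ge1 x).
have nuV2 : in_NW V2 nu by [].
have nuV1 : in_NW V1 nu.
  by split => //; apply: le_lt_trans nuW2; exact: le_normW.
pose v k := fine (normW V1 (iter k S nu)).
pose w k := fine (normW V2 (iter k S nu)).
pose p k := fine (normW (phi1 \o V1) (iter k S nu)).
pose a k := fine (tvnorm (iter k S nu)).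
pose L := lyapunov (K1 / (1 - gammaH)) N v a.
have vE k : normW V1 (iter k S nu) = (v k)%:E by exact: normW_iterE.
have wE k : normW V2 (iter k S nu) = (w k)%:E by exact: normW_iterE.
have pE k : normW (phi1 \o V1) (iter k S nu) = (p k)%:E.
  exact: (normW_rate_iterE V1_ge1 adm1 sto1 s10 drift1 nuV1).
have aE k : tvnorm (iter k S nu) = (a k)%:E by exact: tvnorm_iterE.
have v0 k : 0 <= v k by exact: (iter_normW_ge0 mV1 V1_ge1 sto1 nuV1).
have p0 k : 0 <= p k.
  exact: (iter_rate_ge0 mV1 V1_ge1 adm1 sto1 s10 drift1 nuV1).
have w_le k : w k <= M * w 0%N.
  exact: (iter_normW_bounded mV2 V2_ge1 adm2 sto2 K20 s20 N0 g1 KA2 drift2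
    contr2 nuV2).
have L_ge k : v k <= L k by exact: iter_lyapunov_ge.
have L_le k : L k <= m * v k.
  exact: (iter_lyapunov_le N mV1 V1_ge1 sto1 K10 g1 nuV1).
have L_dec k : L k.+1 + dl * p k <= L k.
  exact: (iter_lyapunov_decrease mV1 V1_ge1 adm1 sto1 K10 s10 N0 g1 KA1 drift1
    contr1 nuV1).
have L_avg j k : dl * (k.+1%:R * a (j + k)%N) <= L j.
  exact: (iter_lyapunov_average mV1 V1_ge1 adm1 sto1 K10 s10 N0 g1 KA1 drift1
    contr1 nuV1).
have L0 k : 0 <= L k by exact: le_trans (v0 k) (L_ge k).
have vw : v 0%N <= w 0%N by rewrite -lee_fin -vE -wE; exact: le_normW.
have w0 : 0 <= w 0%N by exact: le_trans (v0 0%N) vw.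
(* Hypothesis (3) integrated against the variation of [S^k nu]. *)
have interp l k : 0 < l -> l * v k <= p k + xi l * w k.
  move=> l0; rewrite -lee_fin EFinD !EFinM -vE -pE -wE.
  have mphi := measurable_admissible_rate adm1 mV1 V1_ge1.
  have mxi : measurable_fun setT (fun x => xi l * V2 x) by exact: measurable_funM.
  have phi0 x : 0 <= (phi1 \o V1) x.
    by case: adm1 => _ + _ _ => /(_ _ (V1_ge1 x)); exact: le_trans.
  rewrite -(normWZ _ (ltW l0) V1_ge0 mV1) -(normWZ _ (xi0 _ l0) V2_ge0 mV2).
  rewrite -normWD//; last by move=> x; rewrite mulr_ge0// xi0.
  apply: le_normW => //.
  - by move=> x; rewrite mulr_ge0// ltW.
  - exact: measurable_funM.
  - exact: measurable_funD.
  - by move=> x; exact: Hxi.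
have key k t : 0 <= t < dl / m * k%:R -> L k <= Theta xi t * (m * M * w 0%N).
  apply: (le_Theta_scaled xi_small c0 L0).
  - apply: le_trans (L_le 0%N) _; rewrite -mulrA ler_pM2l//.
    by apply: le_trans vw _; rewrite ler_peMl.
  - by move=> j; apply: le_trans (L_dec j); rewrite lerDl mulr_ge0// ltW.
  (* It remains to bound [l * L j] by [m * p j] plus the [xi] term, which chains [L <= m * v], the
     interpolation and the bound [M * w 0] on [w]. *)
  - move=> j l l0; apply: le_trans (L_dec j); rewrite lerD2l -mulrA ler_pM2l//.
    rewrite ler_pdivrMl//.
    have h1 : l * L j <= l * (m * v j) by rewrite ler_pM2l.
    have h2 : m * (l * v j) <= m * (p j + xi l * w j) by rewrite ler_pM2l// interp.
    have h3 : m * (xi l * w j) <= m * (xi l * (M * w 0%N)).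
      by rewrite ler_pM2l// ler_wpM2l ?xi0//; exact: w_le.
    by lra.
set r := dl / m / 4; set Th := Theta xi (r * n%:R).
have r0 : 0 < r by exact: divr_gt0.
have n0 : 0 < n%:R :> R by rewrite ltr0n.
(* Serves both [k = n] and [k = uphalf n]: from [n <= 2 * k] one gets [r * n <= (dl / m) * k / 2],
   strictly below [(dl / m) * k] since [k > 0]. *)
have keyn k : (n <= k.*2)%N -> L k <= Th * (m * M * w 0%N).
  move=> nk; apply: key; rewrite mulr_ge0 ?ltW//=.
  have : n%:R <= 2 * k%:R :> R by rewrite -natrM ler_nat mul2n.
  rewrite -(ler_pM2l r0) => /le_lt_trans; apply.
  have k0 : 0 < k%:R :> R by rewrite ltr0n -double_gt0 (leq_trans n1).
  by have := mulr_gt0 c0 k0; rewrite /r; lra.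
have Th0 : 0 <= Th * (m * M * w 0%N).
  by apply: le_trans (keyn n _) => //; rewrite -addnn leq_addr.
have -> : normW V2 nu = (w 0%N)%:E by rewrite -wE.
rewrite vE aE -!EFinM !lee_fin; split.
- apply: le_trans (L_ge n) _; apply: le_trans (keyn n _) _.
    by rewrite -addnn leq_addr.
  have -> : 2 * (m * M) / dl * Th * w 0%N = 2 / dl * (Th * (m * M * w 0%N)).
    by lra.
  (* The spare factor [2 / dl] is at least 1 because [dl < 1]. *)
  by rewrite ler_peMl// ler_pdivlMr// mul1r; lra.
(* Average over the indices from [uphalf n] to [n], whose number [n./2.+1] is at least [n / 2]; the
   starting value [L (uphalf n)] is already bounded by [keyn]. *)
- have := L_avg (uphalf n) n./2.
  have -> : (uphalf n + n./2)%N = n by rewrite uphalf_half -addnA addnn odd_double_half.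
  have h : (n <= (uphalf n).*2)%N.
    by rewrite uphalf_half doubleD -{1}(odd_double_half n) leq_add2r -addnn leq_addr.
  move=> /le_trans /(_ (keyn _ h)) H.
  have -> : 2 * (m * M) / dl / n%:R * Th * w 0%N = 2 / (dl * n%:R) * (Th * (m * M * w 0%N)).
    by rewrite invfM; lra.
  have dn0 : 0 < dl * n%:R by exact: mulr_gt0.
  rewrite mulrAC ler_pdivlMr//.
  suff : n%:R * a n <= 2 * ((n./2).+1%:R * a n).
    by rewrite -(ler_pM2l dl0); lra.
  rewrite mulrA ler_wpM2r//; first by rewrite /a -lee_fin -aE normW_ge0.
  rewrite -natrM ler_nat mul2n -{1}(odd_double_half n) doubleS.
  by rewrite -addn2 addnC leq_add2l; case: odd.
Qed.
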